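(* Let $n$ be a nonnegative integer and let $a,b,c$ be complex numbers such that no lower parameter of the series below is a nonpositive integer and all denominators below are nonzero. Then $$\frac{c+a+bn}{c+a}\,\frac{(c+a)_n}{(c)_n}=\frac{c+bn}{c}\;{}_7F_6\left[\begin{matrix}-\frac n3,\ \frac{1-n}{3},\ \frac{2-n}{3},\ 1+\frac{c+bn}{2-3b},\ -\frac a2,\ \frac{1-a}{2},\ a+1\\ \frac13,\ \frac23,\ \frac{c+bn}{2-3b},\ \frac{c+1}{2},\ \frac{c+2}{2},\ 1-c-n\end{matrix};1\right]$$ $$+\frac{na(c+1+bn-b)}{c(c+1)}\;{}_7F_6\left[\begin{matrix}\frac{1-n}{3},\ \frac{2-n}{3},\ \frac{3-n}{3},\ 1+\frac{c+1+bn-b}{2-3b},\ \frac{1-a}{2},\ \frac{2-a}{2},\ a+1\\ \frac23,\ \frac43,\ \frac{c+1+bn-b}{2-3b},\ \frac{c+2}{2},\ \frac{c+3}{2},\ 1-c-n\end{matrix};1\right]$$ $$+\frac{na(n-1)(a-1)(c+1+bn-2b)}{2c(c+1)(c-1+n)}\;{}_7F_6\left[\begin{matrix}\frac{2-n}{3},\ \frac{3-n}{3},\ \frac{4-n}{3},\ 1+\frac{c+1+bn-2b}{2-3b},\ \frac{2-a}{2},\ \frac{3-a}{2},\ a+1\\ \frac43,\ \frac53,\ \frac{c+1+bn-2b}{2-3b},\ \frac{c+2}{2},\ \frac{c+3}{2},\ 2-c-n\end{matrix};1\right].$$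
   Context: $(x)_0=1$ and $(x)_n=x(x+1)\cdots(x+n-1)$ for $n\ge1$. The generalized hypergeometric series is ${}_pF_q\left[\begin{matrix}a_1,\dots,a_p\\ b_1,\dots,b_q\end{matrix};z\right]=\sum_{k\ge0}\frac{(a_1)_k\cdots(a_p)_k}{(b_1)_k\cdots(b_q)_k}\frac{z^k}{k!}$, with lower parameters $b_j\in\mathbb{C}\setminus\mathbb{Z}_{\le0}$. The series involved terminate; a term whose coefficient vanishes because of the factor $n$ or $n-1$ (when $n=0$ or $n=1$) is read as $0$. *)

(* Defs.v *)
From mathcomp Require Import all_boot all_order all_algebra.
From mathcomp Require Import all_classical all_reals all_analysis.
From mathcomp Require Import complex.
Set Implicit Arguments.
Unset Strict Implicit.
Unset Printing Implicit Defensive.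
Import Order.TTheory GRing.Theory Num.Theory.
Import numFieldNormedType.Exports.
Local Open Scope ring_scope.
Local Open Scope complex_scope.

Definition poch (R : realType) (x : R[i]) (n : nat) : R[i] :=
  \prod_(k < n) (x + k%:R).

Definition hyperg_term (R : realType) (up lo : seq R[i]) (z : R[i]) (k : nat)
    : R[i] :=
  (\prod_(a <- up) poch a k) / (\prod_(b <- lo) poch b k) * (z ^+ k / k`!%:R).

(* [lim] is total: the value is the sum of the series when the series converges
   (in particular when it terminates) and is unspecified otherwise. *)
Definition hyperg (R : realType) (up lo : seq R[i]) (z : R[i]) : R[i] :=
  limn (series (hyperg_term up lo z : nat -> (R[i] : numFieldType)^o)).

Definition admissible (R : realType) (lo : seq R[i]) : Prop :=
  forall x, x \in lo -> forall m : nat, x <> - m%:R.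

(* Main.v *)
Require Import Defs.
From mathcomp Require Import all_boot all_order all_algebra.
From mathcomp Require Import all_classical all_reals all_analysis.
From mathcomp Require Import complex.
From mathcomp Require Import ring zify.
Import Order.TTheory GRing.Theory Num.Theory.
Import numFieldNormedType.Exports.
Local Open Scope ring_scope.
Local Open Scope complex_scope.

(** Write (x)_k for [poch x k].  The three series are the residue classes modulo
    3 of a single finite sum over m = 3 k + j, j in {0, 1, 2}.  Put
    r = (m + 1) %/ 3 and p = m - r.  By the duplication and triplication
    formulas for Pochhammer symbols, the k-th term of the j-th series, together
    with the coefficient in front of it, is

      C(n, m) (a + m %/ 3 + 1 - m)_m (c + p + b (n - m))
        / ((c)_(p + 1) (c + n - r)_r).

    Here (a + m %/ 3 + 1 - m)_m is the monic polynomial in a with roots at m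
    consecutive integers; the roots are added in the order 0, 1, -1, 2, 3, -2,
    4, 5, -3, ..., so the sum is a Newton interpolation formula.

    Multiplied by (c)_n, such a term is affine in b.  Its constant part is
      C(n, m) (a + m %/ 3 + 1 - m)_m (c + p)_(n - m),
    and since (n - m) C(n, m) = n C(n - 1, m), the coefficient of b is n times
    the same expression with (n, c) replaced by (n - 1, c + 1).  Both parts are
    therefore summed by one identity,

      sum_(m <= n) C(n, m) (a + m %/ 3 + 1 - m)_m (c + p)_(n - m) = (c + a)_n,

    and (c + a)_n + b n (c + 1 + a)_(n - 1) is the left-hand side times (c)_n.

    The identity is [goncarov_vandermonde], for any sequence in place of
    m %/ 3 that increases by 0 or 1 at each step.  It is proved by induction on
    n: the backward difference in a turns each side into n + 1 times the
    identity for n and the shifted sequence, so the difference of the two sides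
    is a 1-periodic polynomial in a, hence constant; and at the first
    interpolation node all terms but the one with m = 0 vanish.
    [hyperg_term_section] carries out the term comparison, and
    [newton_term_comb] recombines the constant part and the part linear in b. *)

Set Implicit Arguments.
Unset Strict Implicit.

(** * Pochhammer symbols *)

Lemma poch0 (R : realType) (x : R[i]) : poch x 0 = 1.
Proof. by rewrite /poch big_ord0. Qed.

Lemma pochS (R : realType) (x : R[i]) n : poch x n.+1 = x * poch (x + 1) n.
Proof.
rewrite /poch big_ord_recl addr0; congr (_ * _).
by apply: eq_bigr => i _; rewrite lift0 -natr1; ring.
Qed.

Lemma pochSr (R : realType) (x : R[i]) n : poch x n.+1 = poch x n * (x + n%:R).
Proof. by rewrite /poch big_ord_recr. Qed.

Lemma pochD (R : realType) (x : R[i]) m n :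
  poch x (m + n) = poch x m * poch (x + m%:R) n.
Proof.
elim: n => [|n IH]; first by rewrite addn0 poch0 mulr1.
by rewrite addnS !pochSr IH natrD; ring.
Qed.

Lemma poch_eq0 (R : realType) (x : R[i]) n i :
  (i < n)%N -> x = - i%:R -> poch x n = 0.
Proof.
move=> lt ->; apply/eqP; rewrite /poch prodf_seq_eq0.
apply/hasP; exists (Ordinal lt); first by rewrite mem_index_enum.
by rewrite /= addNr.
Qed.

Lemma pochN (R : realType) (x : R[i]) n :
  poch (- x) n = (-1) ^+ n * poch (x + 1 - n%:R) n.
Proof.
elim: n => [|n IH]; first by rewrite !poch0 expr0 mulr1.
rewrite pochSr IH pochS exprS -natr1.
have -> : x + 1 - (n%:R + 1) + 1 = x + 1 - n%:R by ring.
ring.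
Qed.

Lemma poch1 (R : realType) n : poch (1 : R[i]) n = n`!%:R.
Proof.
elim: n => [|n IH]; first by rewrite poch0.
by rewrite pochSr IH factS natrM -natr1; ring.
Qed.

Lemma poch_Nnat (R : realType) n m :
  poch (- n%:R : R[i]) m = (-1) ^+ m * m`!%:R * 'C(n, m)%:R.
Proof.
rewrite -mulrA -natrM mulnC bin_ffact.
elim: m => [|m IH]; first by rewrite poch0 ffactn0 mulr1.
rewrite pochSr IH ffactnSr natrM exprS.
case: (leqP m n) => [le|lt]; first by rewrite natrB //; ring.
by rewrite ffact_small // !(mulr0, mul0r).
Qed.

Lemma poch_bisection (R : realType) (x : R[i]) k :
  poch (x / 2) k * poch ((x + 1) / 2) k = poch x (2 * k) / 4 ^+ k.
Proof.
elim: k => [|k IH]; first by rewrite !poch0 expr0; field.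
rewrite mulnS addnC addn2 !pochSr exprS invfM mulrACA IH.
by rewrite -natr1 natrM; field.
Qed.

Lemma poch_trisection (R : realType) (x : R[i]) k :
  poch (x / 3) k * poch ((x + 1) / 3) k * poch ((x + 2) / 3) k
  = poch x (3 * k) / 27 ^+ k.
Proof.
elim: k => [|k IH]; first by rewrite !poch0 expr0; field.
rewrite mulnS addnC addn3 !pochSr exprS invfM.
transitivity (poch x (3 * k) / 27 ^+ k
  * ((x / 3 + k%:R) * ((x + 1) / 3 + k%:R) * ((x + 2) / 3 + k%:R))).
  by rewrite -IH; ring.
by rewrite -!natr1 natrM; field.
Qed.

Lemma poch_shift1 (R : realType) (x : R[i]) k :
  poch x k * (x + k%:R) = x * poch (1 + x) k.
Proof. by rewrite -pochSr pochS [1 + x]addrC. Qed.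

(** The rising factorials are the basic sequence of the backward difference
    operator, as the powers are for the derivative. *)
Lemma poch_diff (R : realType) (x : R[i]) n :
  poch x n.+1 - poch (x - 1) n.+1 = n.+1%:R * poch x n.
Proof. by rewrite pochSr (pochS (x - 1)) subrK -natr1; ring. Qed.

Lemma admissible_poch (R : realType) (lo : seq R[i]) x k :
  admissible lo -> x \in lo -> poch x k != 0.
Proof.
move=> h xin; rewrite /poch prodf_seq_neq0; apply/allP => i _ /=.
by apply/eqP => e; apply: (h x xin i); apply/eqP; rewrite -addr_eq0 e.
Qed.

(** * Interpolation by rising factorials *)

Lemma periodic_poly_eq0 (F : numDomainType) (p : {poly F}) (x : F) :
  p.[x] = 0 -> (forall y, p.[y] = p.[y - 1]) -> p = 0.
Proof.
move=> px0 per; apply/eqP; apply: contraT => p0.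
have px k : p.[x + k%:R] = 0.
  by elim: k => [|k IH]; rewrite ?addr0 // per -natr1 addrA addrK.
have := max_poly_roots (rs := [seq x + k%:R | k <- iota 0 (size p)]) p0.
rewrite size_map size_iota ltnn; apply.
  by apply/allP => _ /mapP[k _ ->]; rewrite /root px.
rewrite map_inj_uniq ?iota_uniq // => i j /addrI /eqP.
by rewrite eqr_nat => /eqP.
Qed.

Definition poch_poly (R : realType) (x : R[i]) n : {poly R[i]} :=
  \prod_(k < n) ('X + (x + k%:R)%:P).

Lemma horner_poch_poly (R : realType) (x : R[i]) n a :
  (poch_poly x n).[a] = poch (a + x) n.
Proof.
rewrite /poch_poly horner_prod; apply: eq_bigr => i _.
by rewrite hornerD hornerX hornerC addrA.
Qed.

(** The Goncarov interpolation formula of the backward difference operator D,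
    applied to the rising factorial (c + a)_n as a polynomial in a.  With
    P_m(a) = (a + k_m + 1 - m)_m, the j-th difference D^j P_m is a multiple of
    (a + k_m + 1 - m)_(m - j), whose roots are the integers from j - k_m to
    m - 1 - k_m.  For j < m the hypothesis on k puts the node j - k_(j+1) among
    them, so that D^j, evaluated at this node, isolates the j-th coefficient. *)
Lemma goncarov_vandermonde (R : realType) n (k : nat -> nat) (a c : R[i]) :
  (forall m, (k m <= k m.+1 <= (k m).+1)%N) ->
  \sum_(m < n.+1) 'C(n, m)%:R * poch (a + (k m)%:R + 1 - m%:R) m
      * poch (c + m%:R - (k m.+1)%:R) (n - m)
  = poch (c + a) n.
Proof.
elim: n k a c => [|n IH] k a c kP.
  by rewrite big_ord1 !poch0 bin0; ring.
have kle m : (k 1%N <= k m.+1 <= k 1%N + m)%N.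
  by elim: m => [|m ih]; [|have := kP m.+1]; lia.
pose p : {poly R[i]} :=
  \sum_(m < n.+2) ('C(n.+1, m)%:R * poch (c + m%:R - (k m.+1)%:R) (n.+1 - m))%:P
      * poch_poly ((k m)%:R + 1 - m%:R) m
  - poch_poly c n.+1.
have pE x : p.[x] =
    \sum_(m < n.+2) 'C(n.+1, m)%:R * poch (x + (k m)%:R + 1 - m%:R) m
      * poch (c + m%:R - (k m.+1)%:R) (n.+1 - m) - poch (c + x) n.+1.
  rewrite hornerD hornerN horner_poch_poly horner_sum [x + c]addrC.
  congr (_ - _); apply: eq_bigr => m _.
  rewrite hornerM hornerC horner_poch_poly !addrA; ring.
suff p0 : p = 0 by apply/eqP; rewrite -subr_eq0 -pE p0 horner0.
apply: (@periodic_poly_eq0 _ _ (- (k 1%N)%:R)).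
  rewrite pE big_ord_recl [X in _ + X - _]big1 ?addr0 => [|m _].
    by rewrite bin0 poch0 subn0 !mul1r subrr.
  (* At a = - k_1 the factor of index m - (k_(m+1) - k_1) of P_(m+1) is zero. *)
  rewrite lift0 (@poch_eq0 _ _ _ (m - (k m.+1 - k 1%N))) ?(mulr0, mul0r) //.
    by rewrite ltnS leq_subr.
  have /andP[le1 le2] := kle m.
  by rewrite !natrB ?leq_subLR // -natr1; ring.
(* Periodicity: the backward difference of both sides is n + 1 times the
   induction hypothesis for the shifted sequence, at a - 1 and c + 1. *)
have sub4 (u v w t : R[i]) : u - v - (w - t) = (u - w) - (v - t) by ring.
move=> x; apply/eqP; rewrite -subr_eq0 !pE sub4 (addrA c x) poch_diff.
rewrite subr_eq0 -sumrB.
rewrite big_ord_recl !poch0 subrr add0r.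
rewrite -[c + x](_ : (c + 1) + (x - 1) = _); last by ring.
rewrite -(IH (k \o S)) => [|m]; last exact: kP.
rewrite mulr_sumr; apply/eqP; apply: eq_bigr => m _.
rewrite lift0 subSS -mulrBl -mulrBr.
set y := x + _ + _ - _.
have -> : x - 1 + (k m.+1)%:R + 1 - m.+1%:R = y - 1 by rewrite /y; ring.
rewrite poch_diff /= !mulrA -!natrM mul_bin_diag [(m.+1 * _)%N]mulnC.
congr (_ * poch _ _ * poch _ _); rewrite /y -natr1; ring.
Qed.

(** * Terminating series and their residue classes *)

Lemma hyperg_terminating (R : realType) (up lo : seq R[i]) (z : R[i]) K :
  (forall k, (K <= k)%N -> hyperg_term up lo z k = 0) ->
  hyperg up lo z = \sum_(k < K) hyperg_term up lo z k.
Proof.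
move=> term0; rewrite /hyperg.
apply: (@norm_lim_near_cst _ (R[i] : numFieldType)^o); exists K => // m /= leKm.
rewrite /series /= -(big_mkord xpredT) (big_cat_nat (n := K)) //=.
by rewrite [X in _ + X]big_nat_cond [X in _ + X]big1 ?addr0 // => k /andP[/andP[/term0]].
Qed.

Lemma sum_nat_sections (R : realType) (f : nat -> R[i]) K :
  \sum_(m < 3 * K) f m =
  \sum_(k < K) f (3 * k + 0)%N + \sum_(k < K) f (3 * k + 1)%N
    + \sum_(k < K) f (3 * k + 2)%N.
Proof.
elim: K => [|K IH]; first by rewrite muln0 !big_ord0 !addr0.
rewrite mulnS addnC addn3 !big_ord_recr /= IH.
by rewrite addn0 addn1 addn2; ring.
Qed.

(** The summand of [goncarov_vandermonde] for k_m = m %/ 3. *)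
Definition newton_term (R : realType) n (a c : R[i]) m : R[i] :=
  'C(n, m)%:R * poch (a + (m %/ 3)%:R + 1 - m%:R) m
    * poch (c + m%:R - (m.+1 %/ 3)%:R) (n - m).

Lemma newton_term_small (R : realType) n (a c : R[i]) m :
  (n < m)%N -> newton_term n a c m = 0.
Proof. by move=> lt; rewrite /newton_term bin_small // !mul0r. Qed.

Lemma sum_newton_term (R : realType) n (a c : R[i]) M :
  (n < M)%N -> \sum_(m < M) newton_term n a c m = poch (c + a) n.
Proof.
move=> lt; rewrite -(@goncarov_vandermonde _ n (fun i => i %/ 3)%N) => [|m]; last by lia.
rewrite -(big_mkord xpredT) (big_cat_nat (n := n.+1)) //= big_mkord.
rewrite [X in _ + X]big_nat_cond [X in _ + X]big1 ?addr0 // => m.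
by case/andP=> /andP[/newton_term_small].
Qed.

(** Apart from the binomial coefficients, for which n C(n - 1, m) is
    (n - m) C(n, m), the summands at (n, c) and at (n - 1, c + 1) differ only by
    (c + p)_(n - m) = (c + p) (c + p + 1)_(n - m - 1), with p = m - r; this is
    what makes their combination a product with one factor affine in b.
    The denominators come from cutting (c)_n into (c)_p (c + p)_(n - m)
    (c + n - r)_r. *)
Lemma newton_term_comb (R : realType) n (a b c : R[i]) m :
  let r := (m.+1 %/ 3)%N in
  poch c n != 0 -> poch c (m - r).+1 != 0 ->
  (newton_term n a c m + b * n%:R * newton_term n.-1 a (c + 1) m) / poch c n
  = 'C(n, m)%:R * poch (a + (m %/ 3)%:R + 1 - m%:R) m
    * (c + (m - r)%:R + b * (n%:R - m%:R))
    / (poch c (m - r).+1 * poch (c + n%:R - r%:R) r).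
Proof.
move=> r cn0 cp0; case: (leqP m n) => [lemn|ltnm]; last first.
  rewrite !newton_term_small ?bin_small ?mulr0 ?addr0 ?mul0r //.
  exact: leq_ltn_trans (leq_pred n) ltnm.
rewrite /newton_term -/r; set P := poch (a + _ + _ - _) _.
have binE : n%:R * 'C(n.-1, m)%:R = (n%:R - m%:R) * 'C(n, m)%:R :> R[i].
  by rewrite -natrB // -!natrM mul_bin_down.
have rm : (r <= m)%N by rewrite /r; lia.
rewrite -[c + m%:R - _]addrA -(natrB _ rm).
have -> : c + 1 + m%:R - r%:R = c + (m - r)%:R + 1 by rewrite natrB //; ring.
set p := (m - r)%N in cp0 *.
transitivity (P * 'C(n, m)%:R * (poch (c + p%:R) (n - m)
   + b * (n%:R - m%:R) * poch (c + p%:R + 1) (n.-1 - m)) / poch c n).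
  congr (_ / _).
  have -> : forall u v, b * n%:R * ('C(n.-1, m)%:R * u * v)
    = b * u * v * (n%:R * 'C(n.-1, m)%:R) by move=> *; ring.
  by rewrite binE; ring.
have cnE : poch c n = poch c p * poch (c + p%:R) (n - m)
                      * poch (c + n%:R - r%:R) r.
  have {1}-> : n = (p + (n - m) + r)%N by rewrite /p; lia.
  rewrite !pochD; congr (_ * poch _ _).
  by rewrite natrD !natrB //; ring.
move: cn0 cp0; rewrite cnE pochSr !mulf_eq0 !negb_or.
case/andP=> /andP[c1 c2] c3 /andP[_ c4].
(* For m = n there is no factor c + p to extract from (c + p)_0; it is supplied
   by the affine factor, which reduces to c + p. *)
case: (ltngtP m n) lemn => // [ltmn|mn] _; last first.
  have -> : n%:R = m%:R :> R[i] by rewrite mn.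
  rewrite -mn subnn poch0 subrr; field; rewrite c1 c4 /=.
  by rewrite mn c3.
have nmE : (n - m = (n.-1 - m).+1)%N by lia.
move: c2; rewrite nmE pochS mulf_eq0 negb_or => /andP[_ c2].
by field; rewrite c1 c2 c3 c4.
Qed.

(** The comparison of terms, uniform in the residue j = m mod 3.  The prefactor
    completes the Pochhammer symbols of the j-th series: (-n)_j and (-a)_j turn
    (j - n)_(3 k) and (j - a)_(2 k) into (-n)_m and (-a)_(2 k + j), and its
    denominator does the same for j!, (c)_(p + 1) and (c + n - r)_r.  The pair
    1 + x over x contributes (x + k) / x, and x d (x + k) / x = x d + k d is
    the factor c + p + b (n - m).  The offsets f and e = j - f are the values
    of r - k and p - 2 k; l1 and l2 are (j + 1) / 3, (j + 2) / 3, (j + 3) / 3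
    with the value 1 left out, which is the parameter that produces k!. *)
Lemma hyperg_term_section (R : realType) n (a b c d x l1 l2 : R[i]) j k :
  let f := (j.+1 %/ 3)%N in
  let e := (j - f)%N in
  let m := (3 * k + j)%N in
  let up := [:: (j%:R - n%:R) / 3; (j%:R - n%:R + 1) / 3; (j%:R - n%:R + 2) / 3;
                1 + x; (j%:R - a) / 2; (j%:R - a + 1) / 2; a + 1] in
  let lo := [:: l1; l2; x; (c + e.+1%:R) / 2; (c + e.+1%:R + 1) / 2;
                1 - c - n%:R + f%:R] in
  (j < 3)%N -> d = 2 - 3 * b ->
  x * d = c + e%:R + b * (n%:R - j%:R) ->
  poch l1 k * poch l2 k * k`!%:R = poch (j.+1%:R) (3 * k) / 27 ^+ k ->
  admissible lo -> poch c n != 0 -> poch c e.+1 != 0 ->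
  poch (c + n%:R - f%:R) f != 0 ->
  x * d * poch (- n%:R) j * poch (- a) j
    / (j`!%:R * poch c e.+1 * poch (c + n%:R - f%:R) f)
    * hyperg_term up lo 1 k
  = (newton_term n a c m + b * n%:R * newton_term n.-1 a (c + 1) m) / poch c n.
Proof.
move=> f e m up lo j3 dE xE lE adm cn0 ce0 cf0.
have adm0 y : y \in lo -> poch y k != 0 by move=> /(admissible_poch k adm).
have [l1n0 l2n0] : poch l1 k != 0 /\ poch l2 k != 0.
  by split; apply: adm0; rewrite !inE eqxx ?orbT.
have xk0 : poch x k != 0 by apply: adm0; rewrite !inE eqxx ?orbT.
have x0 : x != 0.
  have := @admissible_poch _ lo x 1 adm; rewrite pochS poch0 mulr1.
  by apply; rewrite !inE eqxx ?orbT.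
have ck0 : poch (c + e.+1%:R) (2 * k) != 0.
  rewrite -[poch _ (2 * k)](mulfK (expf_neq0 k (_ : 4 != 0))) ?pnatr_eq0 //.
  rewrite mulrAC -poch_bisection !mulf_neq0 ?expf_neq0 ?pnatr_eq0 //;
  by apply: adm0; rewrite !inE eqxx ?orbT.
have rk0 : poch (1 - c - n%:R + f%:R) k != 0.
  by apply: adm0; rewrite !inE eqxx ?orbT.
have fE : (m.+1 %/ 3 = f + k)%N by rewrite /m /f; clear -j3; lia.
have kE : (m %/ 3 = k)%N by rewrite /m; clear -j3; lia.
have pE : (m - (f + k) = e + 2 * k)%N by rewrite /m /e /f; clear -j3; lia.
have cpE : poch c (e + 2 * k).+1 = poch c e.+1 * poch (c + e.+1%:R) (2 * k).
  by rewrite -addSn pochD.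
rewrite newton_term_comb // fE pE ?cpE ?mulf_neq0 // kE.
(* The signs (-1)^k and (-1)^j here, in aE and in rE cancel in the end. *)
have nE : poch (- n%:R) j * poch (j%:R - n%:R) (3 * k)
          = (-1) ^+ (k + j) * m`!%:R * 'C(n, m)%:R :> R[i].
  rewrite [j%:R - _]addrC -pochD addnC -/m poch_Nnat.
  by rewrite /m (exprD _ (3 * k)) (exprD _ k) -(signr_odd _ (3 * k)) oddM signr_odd.
have mE : m`!%:R = j`!%:R * poch (j.+1%:R) (3 * k) :> R[i].
  by rewrite -!poch1 /m addnC pochD -natr1 addrC.
have aE : poch (- a) j * poch (j%:R - a) (2 * k) * poch (a + 1) k
    = (-1) ^+ j * poch (a + k%:R + 1 - m%:R) m.
  rewrite [j%:R - _]addrC -pochD pochN (exprD _ j) (exprM _ 2) sqrrN !expr1n mulr1 -mulrA.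
  congr (_ * _).
  have -> : poch (a + k%:R + 1 - m%:R) m
            = poch (a + k%:R + 1 - m%:R) (j + 2 * k + k).
    by congr poch; rewrite /m; clear; lia.
  rewrite (pochD _ (j + 2 * k)); congr (poch _ _ * poch _ _); rewrite /m; ring.
have rE : poch (c + n%:R - f%:R) f * poch (1 - c - n%:R + f%:R) k
    = (-1) ^+ k * poch (c + n%:R - (f + k)%:R) (f + k).
  have -> : 1 - c - n%:R + f%:R = - (c + n%:R - f%:R - 1) by ring.
  rewrite pochN [(f + k)%N]addnC pochD mulrCA; congr (_ * _).
  by rewrite mulrC; congr (poch _ _ * poch _ _); ring.
have upE : \prod_(y <- up) poch y k
    = poch (j%:R - n%:R) (3 * k) / 27 ^+ k * (poch x k * (x + k%:R) / x)
      * (poch (j%:R - a) (2 * k) / 4 ^+ k) * poch (a + 1) k.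
  rewrite -poch_trisection -poch_bisection poch_shift1 !big_cons big_nil.
  by field.
have loE : (\prod_(y <- lo) poch y k) * k`!%:R
    = poch j.+1%:R (3 * k) / 27 ^+ k * poch x k
      * (poch (c + e.+1%:R) (2 * k) / 4 ^+ k) * poch (1 - c - n%:R + f%:R) k.
  rewrite -lE -poch_bisection !big_cons big_nil; ring.
have j0 : j`!%:R != 0 :> R[i] by rewrite pnatr_eq0 -lt0n fact_gt0.
have jk0 : poch (j.+1%:R : R[i]) (3 * k) != 0.
  have : (m`!%:R : R[i]) != 0 by rewrite pnatr_eq0 -lt0n fact_gt0.
  by rewrite mE mulf_eq0 negb_or => /andP[].
have r0 : poch (c + n%:R - (f + k)%:R) (f + k) != 0.
  have := mulf_neq0 cf0 rk0.
  by rewrite rE mulf_eq0 negb_or => /andP[].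
have q27 : 27 ^+ k != 0 :> R[i] by rewrite expf_neq0 ?pnatr_eq0.
have q4 : 4 ^+ k != 0 :> R[i] by rewrite expf_neq0 ?pnatr_eq0.
have -> : hyperg_term up lo 1 k
    = (\prod_(y <- up) poch y k) / ((\prod_(y <- lo) poch y k) * k`!%:R).
  by rewrite /hyperg_term expr1n div1r invfM mulrA.
rewrite loE upE.
transitivity (d * (x + k%:R)
  * (poch (- n%:R) j * poch (j%:R - n%:R) (3 * k))
  * (poch (- a) j * poch (j%:R - a) (2 * k) * poch (a + 1) k)
  / (j`!%:R * poch (j.+1%:R) (3 * k) * poch c e.+1 * poch (c + e.+1%:R) (2 * k)
     * (poch (c + n%:R - f%:R) f * poch (1 - c - n%:R + f%:R) k))).
  (* Naming the Pochhammer symbols keeps the field normalisation small. *)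
  clear -q27 q4 x0 xk0 j0 jk0 ce0 ck0 cf0 rk0.
  move: (27 ^+ k) q27 (4 ^+ k) q4 (poch x k) xk0 (poch c _) ce0 (poch j.+1%:R _) jk0
    (poch _ (2 * k)) ck0 (poch _ f) cf0 (poch (1 - c - _ + _) _) rk0.
  move=> A q27 B q4 C xk0 D ce0 E jk0 F ck0 G cf0 H rk0.
  by field; rewrite q27 q4 x0 xk0 j0 jk0 ce0 ck0 cf0 rk0.
rewrite nE aE rE mE (exprD _ k j).
have -> : c + (e + 2 * k)%:R + b * (n%:R - m%:R) = d * (x + k%:R).
  have -> : d * (x + k%:R) = x * d + d * k%:R by ring.
  by rewrite xE dE /m; ring.
have s0 u : (-1) ^+ u != 0 :> R[i] by rewrite signr_eq0.
rewrite -(signr_odd _ j); case: (odd j); rewrite ?expr1 ?expr0; field;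
by rewrite s0 j0 jk0 ce0 ck0 r0.
Qed.

(** The lists and the prefactor are arguments with defining equations, so that
    rewriting matches them in whatever form they are written. *)
Lemma hyperg_section (R : realType) n (a b c d x l1 l2 C : R[i]) j e f up lo :
  up = [:: (j%:R - n%:R) / 3; (j%:R - n%:R + 1) / 3; (j%:R - n%:R + 2) / 3;
           1 + x; (j%:R - a) / 2; (j%:R - a + 1) / 2; a + 1] ->
  lo = [:: l1; l2; x; (c + e.+1%:R) / 2; (c + e.+1%:R + 1) / 2;
           1 - c - n%:R + f%:R] ->
  C = x * d * poch (- n%:R) j * poch (- a) j
        / (j`!%:R * poch c e.+1 * poch (c + n%:R - f%:R) f) ->
  (j < 3)%N -> f = (j.+1 %/ 3)%N -> e = (j - f)%N -> d = 2 - 3 * b ->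
  x * d = c + e%:R + b * (n%:R - j%:R) ->
  (forall k, poch l1 k * poch l2 k * k`!%:R
             = poch (j.+1%:R) (3 * k) / 27 ^+ k) ->
  admissible lo -> poch c n != 0 -> poch c e.+1 != 0 ->
  poch (c + n%:R - f%:R) f != 0 ->
  C * hyperg up lo 1
  = \sum_(k < n.+1) (newton_term n a c (3 * k + j)
      + b * n%:R * newton_term n.-1 a (c + 1) (3 * k + j)) / poch c n.
Proof.
move=> -> -> -> j3 -> -> dE xE lE adm cn0 ce0 cf0.
(* For n < j the series need not terminate; its prefactor contains (-n)_j = 0. *)
case: (ltnP n j) => [ltnj|lejn].
  rewrite (@poch_eq0 _ _ j n) // mulr0 !mul0r big1 // => k _.
  by rewrite !newton_term_small ?mulr0 ?addr0 ?mul0r //; clear -ltnj; lia.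
rewrite (@hyperg_terminating _ _ _ _ n.+1) => [|k ltnk].
  rewrite mulr_sumr; apply: eq_bigr => k _.
  exact: hyperg_term_section.
rewrite /hyperg_term; set P := (X in X / _ * _).
suff -> : P = 0 by rewrite !mul0r.
have tri := poch_trisection (j%:R - n%:R : R[i]) k.
rewrite (@poch_eq0 _ (j%:R - n%:R) (3 * k) (n - j)) in tri; last 2 first.
- by clear -ltnk lejn; lia.
- by rewrite natrB // opprB.
by rewrite /P !big_cons mulrA mulrA tri !mul0r.
Qed.

(** * The summation formula *)

Theorem theorem5p2 (R : realType) (n : nat) (a b c : R[i]) :
  let N : R[i] := n%:R in
  let d := 2 - 3 * b in
  let low1 := [:: 1 / 3; 2 / 3; (c + b * N) / d;
                  (c + 1) / 2; (c + 2) / 2; 1 - c - N] in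
  let low2 := [:: 2 / 3; 4 / 3; (c + 1 + b * N - b) / d;
                  (c + 2) / 2; (c + 3) / 2; 1 - c - N] in
  let low3 := [:: 4 / 3; 5 / 3; (c + 1 + b * N - 2 * b) / d;
                  (c + 2) / 2; (c + 3) / 2; 2 - c - N] in
  admissible low1 -> admissible low2 -> admissible low3 ->
  d <> 0 -> c + a <> 0 -> poch c n <> 0 ->
  c <> 0 -> c + 1 <> 0 -> c - 1 + N <> 0 ->
  (c + a + b * N) / (c + a) * (poch (c + a) n / poch c n)
  = (c + b * N) / c
      * hyperg [:: - (N / 3); (1 - N) / 3; (2 - N) / 3;
                   1 + (c + b * N) / d;
                   - (a / 2); (1 - a) / 2; a + 1] low1 1
    + N * a * (c + 1 + b * N - b) / (c * (c + 1))
      * hyperg [:: (1 - N) / 3; (2 - N) / 3; (3 - N) / 3;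
                   1 + (c + 1 + b * N - b) / d;
                   (1 - a) / 2; (2 - a) / 2; a + 1] low2 1
    + N * a * (N - 1) * (a - 1) * (c + 1 + b * N - 2 * b)
        / (2 * c * (c + 1) * (c - 1 + N))
      * hyperg [:: (2 - N) / 3; (3 - N) / 3; (4 - N) / 3;
                   1 + (c + 1 + b * N - 2 * b) / d;
                   (2 - a) / 2; (3 - a) / 2; a + 1] low3 1.
Proof.
move=> N d low1 low2 low3 adm1 adm2 adm3 /eqP d0 /eqP ca0 /eqP cn0 /eqP c0
  /eqP c10 /eqP cn10.
have tri (l1 l2 l3 y : R[i]) k : l1 = y / 3 -> l2 = (y + 1) / 3 ->
    l3 = (y + 2) / 3 -> poch l1 k * poch l2 k * poch l3 k = poch y (3 * k) / 27 ^+ k.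
  by move=> -> -> ->; exact: poch_trisection.
have t1 k : poch (1 / 3 : R[i]) k * poch (2 / 3) k * k`!%:R
          = poch 1%:R (3 * k) / 27 ^+ k.
  by rewrite -poch1; apply: tri; field.
have t2 k : poch (2 / 3 : R[i]) k * poch (4 / 3) k * k`!%:R
          = poch 2%:R (3 * k) / 27 ^+ k.
  by rewrite -poch1 mulrAC; apply: tri; field.
have t3 k : poch (4 / 3 : R[i]) k * poch (5 / 3) k * k`!%:R
          = poch 3%:R (3 * k) / 27 ^+ k.
  by rewrite -poch1 mulrC mulrA; apply: tri; field.
have c2 : poch c 2 != 0 by rewrite pochS pochSr poch0 mul1r addr0 mulf_neq0.
have c1 : poch c 1 != 0 by rewrite pochS poch0 mulr1.
have cnn1 : poch (c + n%:R - 1) 1 != 0 by rewrite pochS poch0 mulr1 addrAC.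
rewrite (@hyperg_section R n a b c d ((c + b * N) / d) _ _ _ 0 0 0 _ _
  _ _ _ _ _ _ _ _ t1 adm1) //; first last.
- by rewrite poch0 oner_neq0.
- by rewrite /N; field.
- by rewrite !pochS !poch0 ?factS fact0; field; rewrite ?d0 c0.
- by congr [:: _; _; _; _; _; _]; rewrite /N; field.
- by congr [:: _; _; _; _; _; _; _]; rewrite /N; field.
rewrite (@hyperg_section R n a b c d ((c + 1 + b * N - b) / d) _ _ _ 1 1 0 _ _
  _ _ _ _ _ _ _ _ t2 adm2) //; first last.
- by rewrite poch0 oner_neq0.
- by rewrite /N; field.
- by rewrite !pochS !poch0 ?factS fact0; field; rewrite ?d0 c0 c10.
- by congr [:: _; _; _; _; _; _]; rewrite /N; field.
- by congr [:: _; _; _; _; _; _; _]; rewrite /N; field.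
rewrite (@hyperg_section R n a b c d ((c + 1 + b * N - 2 * b) / d) _ _ _ 2 1 1 _ _
  _ _ _ _ _ _ _ _ t3 adm3) //; first last.
- by rewrite /N; field.
- by rewrite !pochS !poch0 ?factS fact0; field; rewrite ?d0 c0 c10 -/N [c + N - 1]addrAC cn10.
- by congr [:: _; _; _; _; _; _]; rewrite /N; field.
- by congr [:: _; _; _; _; _; _; _]; rewrite /N; field.
have ltn3 u : (u <= n)%N -> (u < 3 * n.+1)%N by clear; lia.
pose g m := (newton_term n a c m + b * n%:R * newton_term n.-1 a (c + 1) m) / poch c n.
rewrite -(sum_nat_sections g n.+1) /g.
rewrite -mulr_suml big_split -mulr_sumr !sum_newton_term ?ltn3 ?leq_pred //.
rewrite mulrA; congr (_ / _); rewrite -/N.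
(* For n = 0 the symbol (c + 1 + a)_(n - 1) is (c + 1 + a)_0, with coefficient 0. *)
case: n @N {low1 low2 low3 adm1 adm2 adm3 cn0 t1 t2 t3 c1 cnn1 cn10 g ltn3} => [|n] N.
  by rewrite /N /= !poch0; field.
by rewrite pochS /= [c + 1 + a]addrAC; field.
Qed.
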